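(* Let $f:\mathbb{R}^n\to\mathbb{R}$ be a differentiable $\gamma$-strongly quasiconvex function with modulus $\gamma>0$ whose gradient is $L$-Lipschitz continuous, $L>0$. Let $s=\frac1L$, $\alpha\in\left(0,\frac12\right)$ and $$\frac{1-\sqrt{1-16\alpha^4}}{8\alpha}<\beta<\min\left\{\frac{\alpha}{2},\ \frac{1+\sqrt{1-16\alpha^4}}{8\alpha}\right\}.$$ Let $\{\epsilon_k\}\subset\mathbb{R}^n$ be a sequence such that, for some $p>0$, $\|\epsilon_k\|=\mathcal{O}\left(\frac{1}{k^p}\right)$ as $k\to+\infty$. Let $\{x_k\}$ be the sequence generated from initial points $x_0,x_1\in\mathbb{R}^n$ by, for $k\ge1$, $$y_k=x_k+\alpha(x_k-x_{k-1}),\qquad z_k=x_k+\beta(x_k-x_{k-1}),\qquad x_{k+1}=y_k-s\nabla f(z_k)+s\epsilon_k.$$ Then, for $x^*=\mathrm{argmin}_{\mathbb{R}^n}f$, as $k\to+\infty$, $$f(x_k)-f(x^* )=\mathcal{O}\left(\frac{1}{k^{2p}}\right),\qquad \|x_k-x^*\|=\mathcal{O}\left(\frac{1}{k^{p}}\right),\qquad \|x_k-x_{k-1}\|=\mathcal{O}\left(\frac{1}{k^{p}}\right).$$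
   Context: $\mathbb{R}^n$ carries the Euclidean inner product and norm $\|\cdot\|$. A function $f:\mathbb{R}^n\to\mathbb{R}$ is $\gamma$-strongly quasiconvex with modulus $\gamma>0$ if for all $x,y\in\mathbb{R}^n$ and $\lambda\in[0,1]$, $f(\lambda y+(1-\lambda)x)\le\max\{f(y),f(x)\}-\lambda(1-\lambda)\frac{\gamma}{2}\|x-y\|^2$. A lower semicontinuous $\gamma$-strongly quasiconvex function on $\mathbb{R}^n$ has a unique minimizer, so $x^*=\mathrm{argmin}_{\mathbb{R}^n}f$ denotes that point. *)

(* Defs.v *)
From HB Require Import structures.
From mathcomp Require Export all_boot all_order all_algebra.
From mathcomp Require Export all_classical all_reals all_analysis.
Export Order.TTheory GRing.Theory Num.Theory numFieldNormedType.Exports.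

Set Implicit Arguments.
Unset Strict Implicit.
Unset Printing Implicit Defensive.

Local Open Scope classical_set_scope.
Local Open Scope ring_scope.

(* The library's norm on 'rV[R]_n is the sup norm. It defines the same topology
   and the same notion of differentiability as the Euclidean norm, but the
   quantitative bounds below must use the Euclidean one. *)
Definition enorm (R : realType) (n : nat) (x : 'rV[R]_n) : R :=
  Num.sqrt (\sum_(i < n) x ord0 i ^+ 2).

Definition gradient (R : realType) (n : nat) (f : 'rV[R]_n -> R)
    (x : 'rV[R]_n) : 'rV[R]_n :=
  \row_(i < n) 'D_(delta_mx ord0 i) f x.

Definition strongly_quasiconvex (R : realType) (n : nat) (gamma : R)
    (f : 'rV[R]_n -> R) : Prop :=
  forall (x y : 'rV[R]_n) (lambda : R), 0 <= lambda <= 1 ->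
    f (lambda *: y + (1 - lambda) *: x) <=
      Num.max (f y) (f x)
      - lambda * (1 - lambda) * (gamma / 2) * enorm (x - y) ^+ 2.

Definition elipschitz (R : realType) (n : nat) (L : R)
    (F : 'rV[R]_n -> 'rV[R]_n) : Prop :=
  forall x y : 'rV[R]_n, enorm (F x - F y) <= L * enorm (x - y).

(* A global minimizer of f; the value is the junk point 0 only when f has no
   global minimizer. It is the unique minimizer when f is lower semicontinuous
   and gamma-strongly quasiconvex with gamma > 0. *)
Definition argmin (R : realType) (n : nat) (f : 'rV[R]_n -> R) : 'rV[R]_n :=
  xget 0 [set x | forall u : 'rV[R]_n, f x <= f u].

(* Main.v *)
From mathcomp Require Import ring lra.
Require Import Defs.

(** Write d_k = x_k - x_(k-1) for the velocity and c for the minimizer of f.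
    The scheme dissipates the energy

      E_k = f(x_k) - f(c) + L (1/4 + beta^2/2) |d_k|^2

    up to the errors eps_k, and this dissipation is strong enough to dominate
    E_k itself.

    Dissipation ([energy_descent]). A function with L-Lipschitz gradient stays
    within (L/2) |v - u|^2 of its first order expansion at u. Expanding at the
    extrapolated point z_k both towards x_(k+1) and towards x_k bounds
    f(x_(k+1)) - f(x_k) from above; since the gradient at z_k is
    L (alpha d_k - d_(k+1)) + eps_k, the bound is a quadratic form in d_k and
    d_(k+1) plus error terms. With the kinetic weight above the whole form is
    negative definite as soon as 1/2 - beta^2 - (alpha - beta) > 0, which holds
    for 0 <= beta <= alpha < 1/2. No convexity enters here.

    Domination ([energy_error_bound]). Differentiating strong quasiconvexity
    along the segment from u to c gives
    (gamma/2) |u - c|^2 <= <grad f(u), u - c>, so |u - c| is controlled by the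
    gradient at u. At u = z_k this gradient is in turn controlled by d_k,
    d_(k+1) and eps_k, while f(x_k) - f(c) <= (L/2) |x_k - c|^2. Hence E_k is at
    most a constant times |d_k|^2 + |d_(k+1)|^2 + |eps_k|^2.

    Together they give E_(k+1) <= q E_k + M |eps_k|^2 with q < 1
    ([energy_contraction]). A geometric contraction driven by a forcing term of
    order k^(-2p) inherits that order ([contraction_powR_decay]), because
    k^(-2p) decays slower than any geometric sequence. The three rates follow,
    since E_k dominates f(x_k) - f(c), the squared velocity and, by the
    quadratic growth of f around c, also |x_k - c|^2.

    The minimizer exists because strong quasiconvexity makes f coercive
    ([sqc_coercive]). *)

Set Implicit Arguments.
Unset Strict Implicit.
Unset Printing Implicit Defensive.

Local Open Scope classical_set_scope.
Local Open Scope ring_scope.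

(** * The Euclidean inner product *)

Definition edot (R : realType) (n : nat) (u v : 'rV[R]_n) : R :=
  \sum_(i < n) u ord0 i * v ord0 i.

Section EuclideanSpace.
Context {R : realType} {n : nat}.
Implicit Types (u v w : 'rV[R]_n) (a b t : R).

Lemma edotC u v : edot u v = edot v u.
Proof. by apply: eq_bigr => i _; rewrite mulrC. Qed.

Lemma edotDl u v w : edot (u + v) w = edot u w + edot v w.
Proof. by rewrite -big_split; apply: eq_bigr => i _; rewrite mxE mulrDl. Qed.

Lemma edotZl a u v : edot (a *: u) v = a * edot u v.
Proof. by rewrite mulr_sumr; apply: eq_bigr => i _; rewrite mxE mulrA. Qed.

Lemma edotNl u v : edot (- u) v = - edot u v.
Proof. by rewrite -scaleN1r edotZl mulN1r. Qed.

Lemma edotDr u v w : edot w (u + v) = edot w u + edot w v.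
Proof. by rewrite edotC edotDl !(edotC w). Qed.

Lemma edotZr a u v : edot v (a *: u) = a * edot v u.
Proof. by rewrite edotC edotZl edotC. Qed.

Lemma edotNr u v : edot v (- u) = - edot v u.
Proof. by rewrite edotC edotNl edotC. Qed.

Definition edotE := (edotDl, edotDr, edotNl, edotNr, edotZl, edotZr).

Lemma edot_ge0 u : 0 <= edot u u.
Proof. by apply: sumr_ge0 => i _; rewrite -expr2 sqr_ge0. Qed.

Lemma edot_eq0 u : (edot u u == 0) = (u == 0).
Proof.
apply/idP/eqP => [|->]; last by rewrite -(scale0r 0) edotZl mul0r.
rewrite psumr_eq0; last by move=> i _; rewrite -expr2 sqr_ge0.
move=> /allP u0; apply/rowP => i; rewrite mxE; apply/eqP.
by have := u0 i (mem_index_enum i); rewrite /= mulf_eq0 orbb.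
Qed.

Lemma enorm_ge0 u : 0 <= enorm u.
Proof. exact: sqrtr_ge0. Qed.

Lemma enorm_sqr u : enorm u ^+ 2 = edot u u.
Proof.
rewrite sqr_sqrtr; first by apply: eq_bigr => i _; rewrite expr2.
by apply: sumr_ge0 => i _; rewrite sqr_ge0.
Qed.

Lemma enormZ a u : enorm (a *: u) = `|a| * enorm u.
Proof.
apply/eqP; rewrite -(@eqrXn2 _ 2)// ?mulr_ge0 ?enorm_ge0//.
by rewrite exprMn !enorm_sqr edotZl edotZr mulrA -expr2 real_normK// num_real.
Qed.

Lemma enorm_eq0 u : (enorm u == 0) = (u == 0).
Proof. by rewrite -edot_eq0 -enorm_sqr sqrf_eq0. Qed.

Lemma norm_le_enorm u : `|u| <= enorm u.
Proof.
rewrite [leLHS]/Num.norm/= mx_normrE; apply/bigmax_leP.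
split; first exact: enorm_ge0.
move=> [i j] _ /=; rewrite (ord1 i) -(@ler_pXn2r _ 2)// ?nnegrE ?enorm_ge0//.
rewrite enorm_sqr real_normK ?num_real// /edot (bigD1 j)//= expr2 lerDl.
by apply: sumr_ge0 => k _; rewrite -expr2 sqr_ge0.
Qed.

(** This is the positivity of |t u - v|^2, divided by 2t; the weight t lets one
    absorb either factor. *)
Lemma edot_young t u v : 0 < t ->
  edot u v <= t / 2 * edot u u + (2 * t)^-1 * edot v v.
Proof.
move=> t0; have := edot_ge0 (t *: u - v); rewrite !edotE (edotC v u) => H.
have -> : t / 2 * edot u u + (2 * t)^-1 * edot v v =
  edot u v + (2 * t)^-1 * (t * (t * edot u u) + - (t * edot u v) +
   (- (t * edot u v) - - edot v v)) by field; rewrite gt_eqF.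
rewrite lerDl mulr_ge0//; last by lra.
by rewrite invr_ge0 mulr_ge0// ltW.
Qed.

Lemma edot_sqrD u v : edot (u + v) (u + v) <= 2 * edot u u + 2 * edot v v.
Proof. by have := edot_ge0 (u - v); rewrite !edotE (edotC v u); lra. Qed.

(** The instance of the Cauchy-Schwarz inequality that a Lipschitz bound calls
    for; it is Young's inequality with weight 1/a. *)
Lemma normr_edot_le a u v : 0 <= a -> enorm u <= a * enorm v ->
  `|edot u v| <= a * edot v v.
Proof.
rewrite le0r => /predU1P[->|a0].
  rewrite !mul0r => u_le0.
  have /eqP -> : u == 0 by rewrite -enorm_eq0 eq_le u_le0 enorm_ge0.
  by rewrite -(scale0r 0) edotZl mul0r normr0.
move=> uv.
have uu : edot u u <= a ^+ 2 * edot v v.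
  rewrite -!enorm_sqr -exprMn ler_pXn2r// nnegrE ?enorm_ge0//.
  by rewrite mulr_ge0 ?enorm_ge0// ltW.
have ia : 0 < a^-1 by rewrite invr_gt0.
have bound : a^-1 / 2 * edot u u + (2 * a^-1)^-1 * edot v v <= a * edot v v.
  have -> : a * edot v v =
      a^-1 / 2 * (a ^+ 2 * edot v v) + (2 * a^-1)^-1 * edot v v.
    by field; rewrite gt_eqF.
  by rewrite lerD2r ler_pM2l// divr_gt0.
rewrite ler_norml (le_trans (edot_young _ _ ia) bound) andbT.
rewrite lerNl -edotNl (le_trans (edot_young _ _ ia))//.
by rewrite edotNl edotNr opprK.
Qed.

End EuclideanSpace.

(** * Gradients and first order expansions *)

Section Gradient.
Context {R : realType} {n : nat}.
Variable f : 'rV[R]_n -> R.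
Hypothesis f_diff : forall u, differentiable f u.

Implicit Types u v : 'rV[R]_n.

Lemma derive_edot u v : 'D_v f u = edot (gradient f u) v.
Proof.
rewrite deriveE// {1}(row_sum_delta v) linear_sum.
by apply: eq_bigr => i _; rewrite linearZ mxE deriveE// mulrC.
Qed.

Lemma is_derive_line u v (t : R) :
  is_derive t (1 : R) (fun r : R => f (u + r *: v))
    (edot (gradient f (u + t *: v)) v).
Proof.
have E : (fun h => h^-1 *: (((fun r => f (u + r *: v)) \o shift t) (h *: 1) -
                            f (u + t *: v))) =
  (fun h => h^-1 *: ((f \o shift (u + t *: v)) (h *: v) - f (u + t *: v))).
  apply/funext => h /=; congr (_ *: (f _ - _)).
  by rewrite scalerDl /GRing.scale/= mulr1 addrC addrAC addrA.
apply: DeriveDef; rewrite ?/derivable ?/derive E; first exact: diff_derivable.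
by rewrite -[LHS]/('D_v f (u + t *: v)) derive_edot.
Qed.

(** Cauchy's mean value theorem, applied on [0, 1] to the remainder of the
    expansion along the segment from u to v and to t^2, bounds the two signs of
    the remainder at once. *)
Lemma descent_lemma (L : R) u v : 0 <= L -> elipschitz L (gradient f) ->
  `|f v - f u - edot (gradient f u) (v - u)|
    <= L / 2 * edot (v - u) (v - u).
Proof.
move=> L0 lip; set w := v - u.
pose phi t := f (u + t *: w) - t * edot (gradient f u) w.
pose dphi t := edot (gradient f (u + t *: w)) w - edot (gradient f u) w.
have dphiE t : is_derive t (1 : R) phi (dphi t).
  apply: is_deriveB; first exact: is_derive_line.
  apply: is_derive_eq.
  by rewrite /GRing.scale/= mulr0 add0r mulr1.
have dsq t : is_derive t (1 : R) (fun r : R => r ^+ 2) (2 * t).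
  by apply: is_derive_eq; rewrite /GRing.scale/=; ring.
have cont (g dg : R -> R) : (forall t, is_derive t (1 : R) g (dg t)) ->
    {within `[(0 : R), 1], continuous g}.
  move=> gE; apply: continuous_subspaceT => t.
  by apply: differentiable_continuous; apply/derivable1_diffP; case: (gE t).
have dsq_neq0 (t : R) : t \in `]0, 1[ -> 2 * t != 0.
  by rewrite in_itv/= => /andP[t0 _]; rewrite mulf_neq0 ?gt_eqF.
have [t] := cauchy_MVT ltr01 (cont _ _ dphiE) (cont _ _ dsq)
  (fun t _ => dphiE t) (fun t _ => dsq t) dsq_neq0.
rewrite in_itv/= => /andP[t0 t1].
rewrite expr1n expr0n subr0 divr1 /phi scale0r scale1r mul0r mul1r addr0 subr0.
rewrite /w [u + _]addrC subrK -/w => E.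
have -> : f v - f u - edot (gradient f u) w = dphi t / (2 * t).
  by rewrite E addrAC.
rewrite normrM normfV (gtr0_norm (_ : 0 < 2 * t)) ?mulr_gt0//.
rewrite ler_pdivrMr ?mulr_gt0//.
have -> : L / 2 * edot w w * (2 * t) = L * t * edot w w by field.
rewrite /dphi -edotNl -edotDl; apply: normr_edot_le.
  by rewrite mulr_ge0// ltW.
by rewrite (le_trans (lip _ _))// [u + _]addrC addrK enormZ gtr0_norm// mulrA.
Qed.

End Gradient.

(** * Strongly quasiconvex functions *)

Section StronglyQuasiconvex.
Context {R : realType} {n : nat}.
Variables (f : 'rV[R]_n -> R) (gamma : R).
Hypothesis gamma_gt0 : 0 < gamma.
Hypothesis f_sqc : strongly_quasiconvex gamma f.
Implicit Types u v : 'rV[R]_n.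

(** If f(u) <= f(0) with |u| = r > 1, strong quasiconvexity at the point u/r of
    the segment from 0 to u gives f(u/r) <= f(0) - (gamma/2) (r - 1); as u/r
    lies in the unit ball, this bounds r. *)
Lemma sqc_coercive (m : R) : (forall u, `|u| <= 1 -> m <= f u) ->
  forall u, `|u| > 1 + Num.max 0 (2 * (f 0 - m) / gamma) -> f 0 < f u.
Proof.
move=> f_ge u uE; rewrite ltNge; apply/negP => fu.
have : 1 + Num.max 0 (2 * (f 0 - m) / gamma) < enorm u.
  exact: lt_le_trans uE (norm_le_enorm u).
set r := enorm u; set M := Num.max _ _ => Mr.
have M0 : 0 <= M by rewrite /M le_max lexx.
have r_gt0 : 0 < r by lra.
have M1 : f 0 - m <= gamma / 2 * M.
  have : 2 * (f 0 - m) / gamma <= M by rewrite /M le_max lexx orbT.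
  by rewrite ler_pdivrMr// => H; lra.
have r01 : 0 <= r^-1 <= 1 by rewrite invr_ge0 ltW//= invf_le1//; lra.
have := f_sqc 0 u r01; rewrite scaler0 addr0 sub0r.
rewrite -(scaleN1r u) enormZ normrN1 mul1r.
rewrite max_r// -/r.
have -> : r^-1 * (1 - r^-1) * (gamma / 2) * r ^+ 2 = gamma / 2 * (r - 1).
  by field; rewrite gt_eqF.
have : m <= f (r^-1 *: u).
  apply: f_ge; rewrite (le_trans (norm_le_enorm _))// enormZ -/r.
  by rewrite gtr0_norm ?invr_gt0// mulVf// gt_eqF.
have : gamma / 2 * M < gamma / 2 * (r - 1) by rewrite ltr_pM2l ?divr_gt0//; lra.
lra.
Qed.

Lemma closed_ball_min (r : R) : 0 < r -> continuous f ->
  exists2 c, `|c| <= r & forall u, `|u| <= r -> f c <= f u.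
Proof.
move=> r0 cf; pose B := closed_ball_ Num.norm (0 : 'rV[R]_n) r.
have BE u : (u \in B) = (`|u| <= r).
  by apply/idP/idP; rewrite inE /B /closed_ball_/= sub0r normrN.
have B0 : B !=set0 by exists 0; apply: set_mem; rewrite BE normr0 ltW.
have cB : compact B.
  apply: bounded_closed_compact; last exact: closed_closed_ball_.
  exists r; split; first exact: num_real.
  by move=> s rs u /mem_set; rewrite BE => /le_trans; apply; exact: ltW.
have [c cB' fc] := EVT_min_rV B0 cB (continuous_subspaceT cf).
by exists c; [rewrite -BE|move=> u ur; apply: fc; rewrite BE].
Qed.

Lemma sqc_has_min : continuous f -> exists c, forall u, f c <= f u.
Proof.
move=> cf; have [b _ fb] := closed_ball_min ltr01 cf.
have := sqc_coercive fb; set r := 1 + _ => f0.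
have r0 : 0 < r by rewrite ltr_pwDl// le_max lexx.
have [c _ fc] := closed_ball_min r0 cf.
exists c => u; have [/fc//|/f0 /ltW] := leP `|u| r.
by apply: le_trans; apply: fc; rewrite normr0 ltW.
Qed.

Lemma argmin_le : continuous f -> forall u, f (argmin f) <= f u.
Proof. by move=> /sqc_has_min /(xgetPex 0). Qed.

(** Strong quasiconvexity at the midpoint of u and c, where f is at least f(c). *)
Lemma sqc_quadratic_growth c : (forall u, f c <= f u) ->
  forall u, gamma / 8 * edot (u - c) (u - c) <= f u - f c.
Proof.
move=> fc u.
have half01 : 0 <= (2^-1 : R) <= 1 by lra.
have := le_trans (fc _) (f_sqc u c half01).
rewrite max_r// enorm_sqr; lra.
Qed.

Hypothesis f_diff : forall u, differentiable f u.

(** Along the segment from u to v, of squared length D, the difference quotient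
    of f at h is at most -(1 - h) (gamma/2) D; let h tend to 0 from the right. *)
Lemma sqc_gradient_le u v : f v <= f u ->
  edot (gradient f u) (v - u) <= - (gamma / 2 * edot (v - u) (v - u)).
Proof.
move=> fvu; rewrite -derive_edot//.
set D := edot _ _; set w := v - u.
have := diff_derivable (v := w) (f_diff u).
rewrite /derivable => /cvg_dnbhs_at_right.
rewrite -/('D_w f u) => cv.
have cv2 : (fun h : R => - ((1 - h) * (gamma / 2 * D))) @ 0^'+ -->
    - ((1 - 0) * (gamma / 2 * D)).
  apply: cvgN; apply: cvgMl; apply: cvgB; first exact: cvg_cst.
  exact: cvg_at_right_filter.
rewrite subr0 mul1r in cv2.
apply: (ler_cvg_to cv cv2); near=> h.
have h0 : 0 < h by [].
have h01 : 0 <= h <= 1.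
  by rewrite ltW//=; near: h; exact: nbhs_right_le.
have := f_sqc u v h01; rewrite max_r//.
have -> : h *: v + (1 - h) *: u = h *: w + u.
  by rewrite /w scalerBr scalerBl scale1r addrAC addrA.
have -> : enorm (u - v) ^+ 2 = D.
  by rewrite enorm_sqr /D -opprB edotNl edotNr opprK.
rewrite /= /GRing.scale/= ler_pdivrMl// => H.
lra.
Unshelve. all: by end_near. Qed.

(** Young's inequality with weight 2/gamma, applied to
    (gamma/2) |u - c|^2 <= <grad f(u), u - c>, absorbs half of the left side. *)
Lemma sqc_dist_le_gradient c : (forall u, f c <= f u) ->
  forall u, edot (u - c) (u - c) <=
    4 / gamma ^+ 2 * edot (gradient f u) (gradient f u).
Proof.
move=> fc u; have := sqc_gradient_le (fc u).
rewrite -opprB edotNr edotNl edotNr opprK lerN2 => H.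
have := le_trans H (edot_young _ _ (_ : 0 < 2 / gamma)).
rewrite divr_gt0// => /(_ isT).
have -> : (2 * (2 / gamma))^-1 = gamma / 4 by field; rewrite gt_eqF.
have -> : 2 / gamma / 2 = gamma^-1 by field; rewrite gt_eqF.
set G := edot (gradient f u) _; set D := edot _ _ => H'.
have : 4 / gamma * (gamma / 4 * D) <= 4 / gamma * (gamma^-1 * G).
  by rewrite ler_pM2l ?divr_gt0//; lra.
have -> : 4 / gamma * (gamma / 4 * D) = D by field; rewrite gt_eqF.
by have -> : 4 / gamma * (gamma^-1 * G) = 4 / gamma ^+ 2 * G
  by field; rewrite gt_eqF.
Qed.

End StronglyQuasiconvex.

(** * Smooth functions near a minimizer *)

Section SmoothMin.
Context {R : realType} {n : nat}.
Variables (f : 'rV[R]_n -> R) (L : R).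
Hypothesis L_gt0 : 0 < L.
Hypothesis f_diff : forall u, differentiable f u.
Hypothesis grad_lip : elipschitz L (gradient f).

Lemma smooth_min_gap c : (forall u, f c <= f u) ->
  forall u, f u - f c <= L / 2 * edot (u - c) (u - c).
Proof.
move=> fc.
have g0 : gradient f c = 0.
  (* A gradient step of length 1/L from c would lower f by at
     least |g|^2 / (2L). *)
  set g := gradient f c.
  have := descent_lemma f_diff c (c - L^-1 *: g) (ltW L_gt0) grad_lip.
  have -> : c - L^-1 *: g - c = - (L^-1 *: g) by rewrite addrAC subrr add0r.
  rewrite -/g => /ler_normlW; rewrite !edotE !mulrN !opprK.
  have := fc (c - L^-1 *: g).
  have -> : L / 2 * (L^-1 * (L^-1 * edot g g)) = (2 * L)^-1 * edot g g.
    by field; rewrite gt_eqF.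
  have -> : L^-1 = 2 * (2 * L)^-1 by field; rewrite gt_eqF.
  move=> H1 H2; apply/eqP; rewrite -edot_eq0 eq_le edot_ge0 andbT.
  rewrite -(pmulr_rle0 _ (_ : 0 < (2 * L)^-1)) ?invr_gt0 ?mulr_gt0//; lra.
move=> u; have := descent_lemma f_diff c u (ltW L_gt0) grad_lip.
by rewrite g0 -(scale0r 0) edotZl mul0r subr0 => /ler_normlW.
Qed.

End SmoothMin.

(** * Energy of the inertial scheme *)

Section Energy.
Context {R : realType} {n : nat}.
Variables (f : 'rV[R]_n -> R) (L alpha beta : R).
Hypothesis L_gt0 : 0 < L.
Hypothesis f_diff : forall u, differentiable f u.
Hypothesis grad_lip : elipschitz L (gradient f).
Hypothesis beta_ge0 : 0 <= beta.
Hypothesis beta_le : beta <= alpha.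
Hypothesis alpha_lt : alpha < 1 / 2.
Implicit Types x d e : 'rV[R]_n.

Definition next_velocity x d e : 'rV[R]_n :=
  alpha *: d - L^-1 *: gradient f (x + beta *: d) + L^-1 *: e.

(** The kinetic weight is the midpoint of L beta^2 and L/2, the two thresholds
    between which the old velocity and the new one are both damped; with it
    they are damped equally. *)
Definition energy x d : R := f x + L * (1 / 4 + beta ^+ 2 / 2) * edot d d.

(** What is left of the damping L (1/4 - beta^2/2) of each squared velocity once
    half of the coefficient L (alpha - beta) of the cross term is paid. *)
Definition decay_rate : R := L * ((1 / 2 - beta ^+ 2 - (alpha - beta)) / 2).

Lemma decay_rate_gt0 : 0 < decay_rate.
Proof.
have := alpha_lt; have := beta_le; have := beta_ge0 => b0 ba a1.
have b2 : 0 <= beta * (1 - beta) by rewrite mulr_ge0//; lra.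
by rewrite /decay_rate mulr_gt0 ?L_gt0//; lra.
Qed.

(** Solving the recurrence for the gradient replaces it by velocities and the
    error everywhere below. *)
Lemma gradient_step x d e :
  gradient f (x + beta *: d) = L *: (alpha *: d - next_velocity x d e) + e.
Proof.
rewrite /next_velocity !opprD opprK addrA addrA subrr add0r scalerDr scalerN.
by rewrite !scalerA divff ?gt_eqF// !scale1r subrK.
Qed.

(** The bounds around z towards x + v and towards x add up to a quadratic form in
    d, v and e; Young's inequality disposes of the products <d, v> and <e, v>,
    the latter at the price of half of the damping. *)
Lemma energy_descent x d e (v := next_velocity x d e) :
  energy (x + v) v <=
    energy x d - decay_rate / 2 * (edot v v + edot d d)
      + (2 * decay_rate)^-1 * edot e e.
Proof.
set z := x + beta *: d.
have gE : gradient f z = L *: (alpha *: d - v) + e := gradient_step x d e.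
clearbody v.
have up := descent_lemma f_diff z (x + v) (ltW L_gt0) grad_lip.
have lo := descent_lemma f_diff z x (ltW L_gt0) grad_lip.
have zv : x + v - z = v - beta *: d by rewrite /z opprD addrACA subrr add0r.
have zx : x - z = - (beta *: d) by rewrite /z opprD addrA subrr add0r.
move: up lo; rewrite zv zx => /ler_normlP[_ up] /ler_normlP[lo _].
have young := edot_young v e decay_rate_gt0.
have young1 : `|edot d v| <= (edot d d + edot v v) / 2.
  have := edot_ge0 (d - v); have := edot_ge0 (d + v).
  by rewrite !edotE (edotC v d) ler_norml => ? ?; apply/andP; split; lra.
have cross : L * (alpha - beta) * edot d v <=
    L * (alpha - beta) * ((edot d d + edot v v) / 2).
  apply: ler_wpM2l; first by rewrite mulr_ge0 ?subr_ge0 ?(ltW L_gt0).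
  by rewrite (le_trans _ young1)// ler_norm.
have rate_d := mulr_ge0 (ltW decay_rate_gt0) (edot_ge0 d).
move: up lo young cross rate_d; rewrite gE /energy.
set i := (2 * decay_rate)^-1; rewrite /decay_rate.
rewrite !edotE (edotC v d) (edotC e v) (edotC e d).
lra.
Qed.

Variable gamma : R.
Hypothesis gamma_gt0 : 0 < gamma.
Hypothesis f_sqc : strongly_quasiconvex gamma f.

(** The dissipated quantity |v|^2 + |d|^2 controls the gradient at z, hence the
    distance of z, and then of x, to the minimizer, hence the gap of f at x. *)
Lemma energy_error_bound c x d e (v := next_velocity x d e) :
  (forall u, f c <= f u) ->
  energy x d - f c <= (16 * L ^+ 3 / gamma ^+ 2 + L) * (edot v v + edot d d)
    + 8 * L / gamma ^+ 2 * edot e e.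
Proof.
have := alpha_lt; have := beta_le; have := beta_ge0 => b0 ba a1.
move=> fc; set z := x + beta *: d.
have gE : gradient f z = L *: (alpha *: d - v) + e := gradient_step x d e.
clearbody v.
have gap := smooth_min_gap L_gt0 f_diff grad_lip fc x.
have dist := sqc_dist_le_gradient gamma_gt0 f_sqc f_diff fc z.
have xz : x - c = (z - c) + - (beta *: d).
  by rewrite /z addrAC addrK.
have split2 : edot (x - c) (x - c) <=
    2 * edot (z - c) (z - c) + 2 * beta ^+ 2 * edot d d.
  rewrite xz; apply: le_trans (edot_sqrD _ _) _.
  by rewrite edotNl edotNr opprK edotZl edotZr; lra.
have grad_le : edot (gradient f z) (gradient f z) <=
    4 * L ^+ 2 * (edot v v + edot d d) + 2 * edot e e.
  rewrite gE; apply: le_trans (edot_sqrD _ _) _; rewrite lerD2r.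
  rewrite edotZl edotZr.
  have : L ^+ 2 * edot (alpha *: d - v) (alpha *: d - v) <=
      L ^+ 2 * (2 * (edot d d + edot v v)).
    rewrite ler_pM2l ?exprn_gt0//; apply: le_trans (edot_sqrD _ _) _.
    have a2 : alpha ^+ 2 * edot d d <= edot d d.
      rewrite ler_piMl ?edot_ge0// expr_le1//; first by lra.
      exact: le_trans ba.
    by rewrite edotNl edotNr opprK edotZl edotZr; lra.
  lra.
have k_ge0 : 0 <= L * (4 / gamma ^+ 2).
  by rewrite mulr_ge0 ?divr_ge0 ?exprn_ge0// ltW.
have := ler_wpM2l k_ge0 grad_le.
have := ler_wpM2l (ltW L_gt0) dist.
have := ler_wpM2l (divr_ge0 (ltW L_gt0) (ler0n _ 2)) split2.
have : 0 <= L * (1 - 3 / 2 * beta ^+ 2 - 1 / 4) * edot d d.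
  by rewrite mulr_ge0 ?edot_ge0// mulr_ge0 ?(ltW L_gt0)//; nra.
have : 0 <= L * edot v v by rewrite mulr_ge0 ?edot_ge0 ?(ltW L_gt0).
rewrite /energy; move: gap; set g := gamma ^- 2.
lra.
Qed.

(** The dissipated |v|^2 + |d|^2 is at least 1/P times the energy gap, up to |e|^2, by the
    error bound; subtracting it multiplies the gap by q = 1 - k / (2 P). *)
Lemma energy_contraction : exists q M : R, [/\ 0 < q < 1, 0 <= M &
  forall c x d e v, (forall u, f c <= f u) -> v = next_velocity x d e ->
  energy (x + v) v - f c <= q * (energy x d - f c) + M * edot e e].
Proof.
set P := 16 * L ^+ 3 / gamma ^+ 2 + L; set Q := 8 * L / gamma ^+ 2.
have Q_ge0 : 0 <= Q by rewrite divr_ge0 ?mulr_ge0 ?exprn_ge0// ltW.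
have P_ge : L <= P by rewrite lerDr divr_ge0 ?mulr_ge0 ?exprn_ge0// ltW.
have P_gt0 : 0 < P by exact: lt_le_trans P_ge.
have k_gt0 := decay_rate_gt0; set k := decay_rate in k_gt0.
have k_le : k <= L.
  have := beta_le; have := sqr_ge0 beta.
  by rewrite /k /decay_rate ger_pMr// => *; lra.
exists (1 - k / (2 * P)), ((2 * k)^-1 + k / (2 * P) * Q); split.
- have : 0 < k / (2 * P) by rewrite divr_gt0// mulr_gt0.
  have : k / (2 * P) < 1 by rewrite ltr_pdivrMr ?mulr_gt0//; lra.
  by move=> *; apply/andP; split; lra.
- have k2P : 0 <= k / (2 * P) by rewrite divr_ge0 ?(ltW k_gt0)// mulr_ge0// ltW.
  by rewrite addr_ge0 ?(mulr_ge0 k2P Q_ge0)// invr_ge0 mulr_ge0// ltW.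
move=> c x d e v fc vE.
have := energy_descent x d e; have := energy_error_bound x d e fc.
rewrite -vE -/P -/Q -/k; set S := edot v v + edot d d; set ee := edot e e.
move=> bnd desc.
have : k / (2 * P) * (energy x d - f c) <= k / (2 * P) * (P * S + Q * ee).
  by rewrite ler_pM2l// divr_gt0// mulr_gt0.
have -> : k / (2 * P) * (P * S + Q * ee) = k / 2 * S + k / (2 * P) * Q * ee.
  by field; rewrite gt_eqF.
move: desc; cbv zeta; rewrite -/S => desc H.
set j := k / (2 * P) in H *; set i := (2 * k)^-1 in desc *.
clearbody S j i; lra.
Qed.

End Energy.

(** * Perturbed geometric recursions and power rates *)

Section Recursion.
Context {R : realType}.

Lemma powR_succ_le (r : R) (k : nat) : 0 <= r -> (0 < k)%N ->
  k.+1%:R `^ r <= expR (r / k%:R) * k%:R `^ r.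
Proof.
move=> r0 k0; have k_gt0 : 0 < k%:R :> R by rewrite ltr0n.
rewrite mulrC [r / _]mulrC expRM -powRM ?expR_ge0//.
apply: ge0_ler_powR => //; rewrite ?nnegrE//.
have := expR_ge1Dx (k%:R^-1 : R); rewrite -(ler_pM2l k_gt0).
by rewrite mulrDr mulr1 mulfV ?gt_eqF// natr1.
Qed.

(** The bound A / k^r passes from k to k + 1 as soon as k^r / (k+1)^r is at least
    t = sqrt q: the contraction then gains a factor q = t^2 and loses only 1/t,
    which leaves the room A t (1 - t) >= M for the forcing term. *)
Lemma contraction_powR_decay (E : nat -> R) (q M r : R) (K : nat) :
  0 < q < 1 -> 0 <= M -> 0 <= r ->
  (forall k, (K <= k)%N -> E k.+1 <= q * E k + M / k%:R `^ r) ->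
  exists A : R, exists N : nat,
    0 < A /\ forall k, (N <= k)%N -> E k <= A / k%:R `^ r.
Proof.
move=> /andP[q0 q1] M0 r0 rec.
pose t := Num.sqrt q.
have t0 : 0 < t by rewrite sqrtr_gt0.
have t2 : t ^+ 2 = q by rewrite sqr_sqrtr// ltW.
have t1 : t < 1 by rewrite -(@ltr_pXn2r _ 2)// ?nnegrE ?ltW// t2 expr1n.
have l0 : 0 < - ln t by rewrite oppr_gt0 ln_lt0// t0.
have [N0 N0P] : exists N0 : nat, r / - ln t <= N0%:R.
  exists (Num.bound (r / - ln t)); apply/ltW/archi_boundP.
  by rewrite divr_ge0 ?(ltW l0).
(* Beyond N0, expR (r / k) <= 1 / t; the second entry of A starts the induction. *)
pose N := maxn (maxn N0 K) 1.
pose A := Num.max (1 + M / (t * (1 - t))) (E N * N%:R `^ r).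
have A_ge : M <= t * (1 - t) * A.
  have tt : 0 < t * (1 - t) by rewrite mulr_gt0// subr_gt0.
  rewrite mulrC -ler_pdivrMr//; apply: (@le_trans _ _ (1 + M / (t * (1 - t)))).
    by rewrite lerDr.
  by rewrite /A le_max lexx.
exists A, N; split.
  rewrite lt_max; apply/orP; left; rewrite ltr_pwDl//.
  rewrite divr_ge0// mulr_ge0 ?(ltW t0)//.
  by rewrite subr_ge0 ltW.
have pow0 k : (N <= k)%N -> 0 < k%:R `^ r :> R.
  by move=> Nk; rewrite powR_gt0// ltr0n (leq_trans _ Nk)// leq_maxr.
elim=> [|k IH].
  by rewrite leqNgt leq_max orbT.
rewrite leq_eqVlt => /predU1P[NE|].
  by rewrite -NE ler_pdivlMr ?pow0// /A le_max lexx orbT.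
rewrite ltnS => Nk.
have k0 : (0 < k)%N by rewrite (leq_trans _ Nk)// leq_maxr.
have Kk : (K <= k)%N by rewrite (leq_trans _ Nk)// !leq_max leqnn orbT.
have N0k : (N0 <= k)%N by rewrite (leq_trans _ Nk)// !leq_max leqnn.
have succ : k.+1%:R `^ r <= t^-1 * k%:R `^ r.
  rewrite (le_trans (powR_succ_le r0 k0))// ler_wpM2r ?powR_ge0//.
  rewrite -[leRHS]lnK ?posrE ?invr_gt0// ler_expR lnV ?posrE//.
  rewrite ler_pdivrMr ?ltr0n// mulrC -ler_pdivrMr// (le_trans N0P)//.
  by rewrite ler_nat.
rewrite ler_pdivlMr ?pow0 1?ltnW//.
set E1 := E k.+1.
have E1_le : E1 <= t * A / k%:R `^ r.
  apply: (le_trans (rec k Kk)).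
  have : q * E k <= q * (A / k%:R `^ r) by rewrite ler_pM2l// IH.
  have : M / k%:R `^ r <= t * (1 - t) * A / k%:R `^ r.
    by rewrite ler_pM2r ?invr_gt0 ?pow0.
  rewrite -t2.
  have -> : t * A / k%:R `^ r =
      t ^+ 2 * (A / k%:R `^ r) + t * (1 - t) * A / k%:R `^ r by ring.
  lra.
have tA0 : 0 <= t * A / k%:R `^ r.
  rewrite divr_ge0 ?powR_ge0// mulr_ge0 ?(ltW t0)//.
  rewrite /A le_max addr_ge0// divr_ge0// mulr_ge0 ?(ltW t0)//.
  by rewrite subr_ge0 ltW.
apply: (le_trans (ler_wpM2r (powR_ge0 _ _) E1_le)).
apply: (le_trans (ler_wpM2l tA0 succ)).
rewrite le_eqVlt; apply/orP; left; apply/eqP; field.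
by rewrite !gt_eqF ?pow0.
Qed.

End Recursion.

Section PowerRates.
Context {R : realType}.

Lemma powR_double (a p : R) : a `^ (2 * p) = (a `^ p) ^+ 2.
Proof. by rewrite mulrC powRrM powR_mulrn// powR_ge0. Qed.

Lemma eqO_powR_exP (g : nat -> R) (p : R) :
  g =O_\oo (fun k => 1 / (k%:R `^ p : R)) <->
  exists A : R, exists N : nat, forall k, (N <= k)%N -> `|g k| <= A / k%:R `^ p.
Proof.
have normE k : `|1 / (k%:R `^ p : R)| = (k%:R `^ p)^-1.
  by rewrite div1r ger0_norm// invr_ge0 powR_ge0.
split=> [/eqO_exP[A _ [N _ gA]]|[A [N gA]]].
  by exists A, N => k Nk; rewrite -normE; exact: gA.
apply/eqO_exP; exists (Num.max 1 A); first by rewrite lt_max ltr01.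
exists N => // k Nk /=; rewrite normE (le_trans (gA k Nk))//.
by rewrite ler_wpM2r ?invr_ge0 ?powR_ge0// le_max lexx orbT.
Qed.

Lemma eqO_of_sqr_le (g : nat -> R) (p A : R) (N : nat) : 0 <= A ->
  (forall k, (N <= k)%N -> g k ^+ 2 <= A / k%:R `^ (2 * p)) ->
  g =O_\oo (fun k => 1 / (k%:R `^ p : R)).
Proof.
move=> A0 gA; apply/eqO_powR_exP; exists (Num.sqrt A), N => k Nk.
rewrite -(@ler_pXn2r _ 2)// ?nnegrE ?divr_ge0 ?sqrtr_ge0 ?powR_ge0//.
by rewrite expr_div_n sqr_sqrtr// -powR_double real_normK ?num_real// gA.
Qed.

End PowerRates.

Theorem theorem4p2 (R : realType) (n : nat) (f : 'rV[R]_n -> R)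
    (gamma L s alpha beta p : R) (eps x y z : nat -> 'rV[R]_n)
    (gamma_gt0 : 0 < gamma)
    (L_gt0 : 0 < L)
    (f_diff : forall u : 'rV[R]_n, differentiable f u)
    (f_sqc : strongly_quasiconvex gamma f)
    (grad_lip : elipschitz L (gradient f))
    (s_def : s = 1 / L)
    (alpha_bnd : 0 < alpha < 1 / 2)
    (beta_bnd : (1 - Num.sqrt (1 - 16 * alpha ^+ 4)) / (8 * alpha) < beta
      < Num.min (alpha / 2)
                ((1 + Num.sqrt (1 - 16 * alpha ^+ 4)) / (8 * alpha)))
    (p_gt0 : 0 < p)
    (eps_bigO : (fun k : nat => enorm (eps k)) =O_\oo
                (fun k : nat => 1 / (k%:R `^ p : R)))
    (y_def : forall k : nat, (1 <= k)%N ->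
      y k = x k + alpha *: (x k - x (k - 1)%N))
    (z_def : forall k : nat, (1 <= k)%N ->
      z k = x k + beta *: (x k - x (k - 1)%N))
    (x_def : forall k : nat, (1 <= k)%N ->
      x (k + 1)%N = y k - s *: gradient f (z k) + s *: eps k) :
  [/\ (fun k : nat => f (x k) - f (argmin f)) =O_\oo
        (fun k : nat => 1 / (k%:R `^ (2 * p) : R)),
      (fun k : nat => enorm (x k - argmin f)) =O_\oo
        (fun k : nat => 1 / (k%:R `^ p : R)) &
      (fun k : nat => enorm (x k - x (k - 1)%N)) =O_\oo
        (fun k : nat => 1 / (k%:R `^ p : R))].
Proof.
have f_cont : continuous f by move=> u; exact: differentiable_continuous.
have f_min := argmin_le gamma_gt0 f_sqc f_cont.
set c := argmin f in f_min *.
have /andP[alpha_gt0 alpha_lt] := alpha_bnd.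
(* The square root is at most 1, so the lower bound on beta is nonnegative. *)
have [beta_ge0 beta_le] : 0 <= beta /\ beta <= alpha.
  have /andP[lb] := beta_bnd; rewrite lt_min => /andP[ub _].
  split; last by lra.
  apply/ltW/(le_lt_trans _ lb).
  rewrite divr_ge0 ?mulr_ge0 ?(ltW alpha_gt0)// subr_ge0 -[leRHS]sqrtr1.
  by rewrite ler_wsqrtr// gerBl mulr_ge0// exprn_ge0// ltW.
pose d k := x k - x (k - 1)%N.
have d_rec k : (1 <= k)%N ->
    d k.+1 = next_velocity f L alpha beta (x k) (d k) (eps k).
  move=> k1; have := x_def k k1; rewrite y_def// z_def// s_def div1r addn1.
  rewrite -/(d k) => xk; rewrite [LHS]/d subn1 /= xk.
  by rewrite /next_velocity addrC !addrA addNr add0r.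
have x_rec k : x k.+1 = x k + d k.+1.
  by rewrite /d subn1 /= addrC subrK.
have [q [M [q01 M0 contr]]] :=
  energy_contraction L_gt0 f_diff grad_lip beta_ge0 beta_le alpha_lt
    gamma_gt0 f_sqc.
have [a [N eps_le]] := (eqO_powR_exP _ _).1 eps_bigO.
pose E k := energy f L beta (x k) (d k) - f c.
have [A [K [A0 E_le]]] : exists A : R, exists K : nat,
    0 < A /\ forall k, (K <= k)%N -> E k <= A / k%:R `^ (2 * p).
  apply: (@contraction_powR_decay _ E q (M * a ^+ 2) (2 * p) (maxn N 1)) => //.
  - by rewrite mulr_ge0// sqr_ge0.
  - by rewrite mulr_ge0// ltW.
  move=> k; rewrite geq_max => /andP[Nk k1].
  rewrite /E {1}x_rec; apply: le_trans.
    exact: contr c _ _ (eps k) _ f_min (d_rec k k1).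
  rewrite lerD2l -mulrA ler_wpM2l// -enorm_sqr powR_double -expr_div_n.
  have := eps_le k Nk; rewrite ger0_norm ?enorm_ge0// => e_le.
  by rewrite ler_pXn2r// nnegrE ?enorm_ge0// (le_trans (enorm_ge0 _) e_le).
pose w := L * (1 / 4 + beta ^+ 2 / 2).
have w_gt0 : 0 < w by rewrite mulr_gt0//; have := sqr_ge0 beta; lra.
have gap_ge0 k : 0 <= f (x k) - f c by rewrite subr_ge0.
have kin_ge0 k : 0 <= w * edot (d k) (d k) by rewrite mulr_ge0 ?edot_ge0// ltW.
have gap_le k : f (x k) - f c <= E k.
  by rewrite /E /energy -/w; have := kin_ge0 k; lra.
have kin_le k : w * edot (d k) (d k) <= E k.
  by rewrite /E /energy -/w; have := gap_ge0 k; lra.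
split.
- apply/eqO_powR_exP; exists A, K => k Kk.
  by rewrite ger0_norm// (le_trans (gap_le k))// E_le.
- apply: (@eqO_of_sqr_le _ _ _ ((gamma / 8)^-1 * A) K).
    by rewrite mulr_ge0 ?invr_ge0 ?divr_ge0// ltW.
  move=> k Kk; rewrite enorm_sqr -mulrA mulrC ler_pdivlMr ?divr_gt0// mulrC.
  apply: le_trans (sqc_quadratic_growth f_sqc f_min (x k)) _.
  exact: le_trans (gap_le k) (E_le k Kk).
- apply: (@eqO_of_sqr_le _ _ _ (w^-1 * A) K).
    by rewrite mulr_ge0 ?invr_ge0// ltW.
  move=> k Kk; rewrite enorm_sqr -/(d k) -mulrA mulrC ler_pdivlMr// mulrC.
  exact: le_trans (kin_le k) (E_le k Kk).
Qed.
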